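(* Let $T$ be an NIP theory, work in a sufficiently saturated model, and let $K$ be a type-definable field of characteristic $p>0$ such that there is no infinite decreasing sequence $H_0\supseteq H_1\supseteq H_2\supseteq\cdots$ of type-definable subgroups of $(K,+)$ with each $H_{i+1}$ of unbounded index in $H_i$. Then $K$ is Artin–Schreier closed, i.e. for every $a\in K$ there is $x\in K$ with $x^p-x=a$.
   Context: $T$ is NIP if there is no formula $\phi(\bar x,\bar y)$ and model with tuples $(\bar a_i)_{i\in\omega}$, $(\bar b_I)_{I\subseteq\omega}$ satisfying $\models\phi(\bar a_i,\bar b_I)$ iff $i\in I$. A type-definable set/group is one defined by a partial type over a small set of parameters. A subgroup has bounded index if the index is bounded by a cardinal independent of the elementary extension considered (i.e. smaller than the saturation of the monster model); otherwise it has unbounded index.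
   Formalization: K is additionally assumed infinite: for a finite field such as F_p all indices are finite, so the chain condition holds, yet x^p − x is never surjective on a finite field of characteristic p. *)

(* Defs.v *)
From HB Require Import structures.
From mathcomp Require Import all_boot all_order all_algebra.
From mathcomp Require Import boolp classical_sets functions cardinality.

Set Implicit Arguments.
Unset Strict Implicit.
Unset Printing Implicit Defensive.

Import GRing.Theory.

Local Open Scope classical_set_scope.
Local Open Scope card_scope.
Local Open Scope ring_scope.

Record language := Language {
  fsym : Type;
  rsym : Type;
  farity : fsym -> nat;
  rarity : rsym -> nat }.

Record structure (L : language) := Structure {
  carrier :> Type;
  finterp : forall f : fsym L, (farity f).-tuple carrier -> carrier;
  rinterp : forall r : rsym L, (rarity r).-tuple carrier -> Prop }.

Inductive term (L : language) (n : nat) :=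
| Var : 'I_n -> term L n
| App (f : fsym L) : ('I_(farity f) -> term L n) -> term L n.

(* [formula L n] has its free variables among those indexed by 'I_n.  [All]
   binds variable 0; variable i of [All phi] is variable i.+1 of [phi].       *)
Inductive formula (L : language) : nat -> Type :=
| Eq n : term L n -> term L n -> formula L n
| Rel n (r : rsym L) : ('I_(rarity r) -> term L n) -> formula L n
| Bot n : formula L n
| Imp n : formula L n -> formula L n -> formula L n
| All n : formula L n.+1 -> formula L n.

Fixpoint eval (L : language) (M : structure L) (n : nat) (v : n.-tuple M)
    (t : term L n) : M :=
  match t with
  | Var i => tnth v i
  | App f ts => finterp [tuple eval v (ts i) | i < farity f]
  end.

Fixpoint sat (L : language) (M : structure L) (n : nat) (phi : formula L n) :
    n.-tuple M -> Prop :=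
  match phi in formula _ n return n.-tuple M -> Prop with
  | Eq _ t u => fun v => eval v t = eval v u
  | Rel _ r ts => fun v => rinterp [tuple eval v (ts i) | i < rarity r]
  | Bot _ => fun _ => False
  | Imp _ phi psi => fun v => sat phi v -> sat psi v
  | All _ phi => fun v => forall m : M, sat phi [tuple of m :: v]
  end.

Definition theory (L : language) := set (formula L 0).

Definition model (L : language) (T : theory L) (M : structure L) : Prop :=
  forall phi, T phi -> @sat L M 0 phi [tuple].

Definition NIP (L : language) (T : theory L) : Prop :=
  ~ exists (n m : nat) (phi : formula L (n + m)) (M : structure L),
      model T M /\
      exists (a : nat -> n.-tuple M) (b : set nat -> m.-tuple M),
        forall (i : nat) (I : set nat), sat phi [tuple of a i ++ b I] <-> I i.

(* Cardinals are represented by types: |A| < |kappa|. *)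
Definition small (kappa : Type) (T : Type) (A : set T) : Prop :=
  ~ ([set: kappa] #<= A).

Definition strong_limit (kappa : Type) : Prop :=
  forall X : Type, small kappa [set: X] -> small kappa [set: set X].

(* phi(x, a) with x an n-tuple of variables and a a finite tuple from M. *)
Record pformula (L : language) (M : structure L) (n : nat) := PFormula {
  nparam : nat;
  pform : formula L (n + nparam);
  param : nparam.-tuple M }.

Section TypeDefinability.
Variables (L : language) (M : structure L).

Definition holds (n : nat) (f : pformula M n) (x : n.-tuple M) : Prop :=
  sat (pform f) [tuple of x ++ param f].

Definition realizes (n : nat) (x : n.-tuple M) (q : set (pformula M n)) : Prop :=
  forall f, q f -> holds f x.

Definition over (A : set M) (n : nat) (q : set (pformula M n)) : Prop :=
  forall f, q f -> forall i, A (tnth (param f) i).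

Definition finitely_satisfiable (n : nat) (q : set (pformula M n)) : Prop :=
  forall q0, q0 `<=` q -> finite_set q0 -> exists x, realizes x q0.

Definition saturated (kappa : Type) : Prop :=
  forall A : set M, small kappa A ->
  forall (n : nat) (q : set (pformula M n)),
    over A q -> finitely_satisfiable q -> exists x, realizes x q.

(* That kappa is a strong limit above |L| + aleph_0 makes "index smaller than
   kappa" agree with "index bounded independently of the elementary
   extension", for subgroups type-definable over fewer than kappa parameters. *)
Record sufficiently_saturated (kappa : Type) : Prop := SufficientlySaturated {
  small_nat : small kappa [set: nat];
  small_fsym : small kappa [set: fsym L];
  small_rsym : small kappa [set: rsym L];
  kappa_strong_limit : strong_limit kappa;
  kappa_saturated : saturated kappa }.

Definition type_definable (kappa : Type) (n : nat) (D : set (n.-tuple M)) : Prop :=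
  exists (A : set M) (q : set (pformula M n)),
    [/\ small kappa A, over A q & D = [set x | realizes x q]].

(* The field F is identified by e with a subset of M^n; the graphs of the
   operations are subsets of M^(n + n + n). *)
Record type_definable_field (kappa : Type) (n : nat) (F : fieldType)
    (e : F -> n.-tuple M) : Prop := TypeDefinableField {
  field_inj : injective e;
  field_carrier : type_definable kappa (range e);
  field_add : type_definable kappa
    [set t | exists x y : F, t = [tuple of (e x ++ e y) ++ e (x + y)]];
  field_mul : type_definable kappa
    [set t | exists x y : F, t = [tuple of (e x ++ e y) ++ e (x * y)]] }.

Record type_definable_subgroup (kappa : Type) (n : nat) (F : fieldType)
    (e : F -> n.-tuple M) (H : set F) : Prop := TypeDefinableSubgroup {
  subgroup0 : H 0;
  subgroupB : forall x y, H x -> H y -> H (x - y);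
  subgroup_type_definable : type_definable kappa (e @` H) }.

End TypeDefinability.

Definition cosets (V : zmodType) (G H : set V) : set (set V) :=
  [set [set x + h | h in H] | x in G].

Definition unbounded_index (kappa : Type) (V : zmodType) (G H : set V) : Prop :=
  ~ small kappa (cosets G H).

Definition artin_schreier_closed (F : fieldType) (p : nat) : Prop :=
  forall a : F, exists x : F, x ^+ p - x = a.

(* Main.v *)
(** Write [wp x = x ^+ p - x].  In the chain of type-definable subgroups
    [wp^i F], some [wp^(i+1) F] has bounded index in [wp^i F]; as [wp] is additive
    with finite kernel, [wp F] has bounded index in [F].  It remains to see that
    NIP forbids a proper type-definable subgroup [H] of bounded index.

    By compactness [H] lies in a decreasing sequence of relatively definable sets
    [G_k] with [G_(k+1) - G_(k+1)] inside [G_k] and [G_0] proper, so that every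
    nonzero [x] has a multiple outside some [G_k].  As [F] is large, for some [k]
    every small intersection of the groups [{x | a x \in H}] contains many elements
    that are pairwise separated by the sets [{x | a x \in G_k}].  Iterating this and
    using the pigeonhole principle in the bounded quotient [F / H], one finds, for
    every N, elements [a_i], [d_j] with [a_i d_j \in H] for [i != j] and
    [a_i d_i \notin G_k].  Sums of the [d_j] then shatter the [a_i] for a formula
    separating [a x \in H] from [a x \notin G_(k+1)].  This replaces the extraction
    of an indiscernible sequence in the usual proof that G^00 exists. *)

Require Import Defs.
From mathcomp Require Import all_boot all_order all_algebra.
From mathcomp Require Import boolp classical_sets functions cardinality.
From mathcomp Require Import ring.

Set Implicit Arguments.
Unset Strict Implicit.
Unset Printing Implicit Defensive.

Import GRing.Theory.

Local Open Scope classical_set_scope.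
Local Open Scope ring_scope.

(** * Cardinals below a strong limit *)

(** Comparability of cardinals: Zorn gives a maximal partial injection [R], and if it missed a point
    on both sides, the pair of these points could be added. *)
Lemma injection_total (X Y : Type) :
  (exists f : X -> Y, injective f) \/ (exists f : Y -> X, injective f).
Proof.
pose P (R : set (X * Y)) :=
  (forall x y y', R (x, y) -> R (x, y') -> y = y') /\
  (forall x x' y, R (x, y) -> R (x', y) -> x = x').
have [G FP totG|R [[Rfun Rinj] Rmax]] := @Zorn_bigcup _ P.
  split=> [x y y' [A GA Axy] [B GB Bxy]|x x' y [A GA Axy] [B GB Bxy]].
    by have [AB|BA] := totG _ _ GA GB;
      [apply: (FP _ GB).1 Bxy; exact: AB|apply: (FP _ GA).1 Axy _; exact: BA].
  by have [AB|BA] := totG _ _ GA GB;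
    [apply: (FP _ GB).2 Bxy; exact: AB|apply: (FP _ GA).2 Axy _; exact: BA].
have [Xtot|/existsNP[x Nx]] := pselect (forall x, exists y, R (x, y)).
  have [f fP] := choice Xtot.
  by left; exists f => x x' fxx'; apply: Rinj (fP x) _; rewrite fxx'.
have [Ytot|/existsNP[y Ny]] := pselect (forall y, exists x, R (x, y)).
  have [f fP] := choice Ytot.
  by right; exists f => y y' fyy'; apply: Rfun (fP y) _; rewrite fyy'.
exfalso; apply: (Rmax (R `|` [set (x, y)])).
  rewrite properEneq; split; last by move=> t Rt; left.
  apply/eqP => E; apply: Nx; exists y; rewrite E; right; reflexivity.
split=> [a b b' [Rab|abE] [Rab'|ab'E]|a a' b [Rab|abE] [Ra'b|a'bE]].
- exact: Rfun Rab Rab'.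
- by case: ab'E Rab => -> _ Rxb; case: Nx; exists b.
- by case: abE Rab' => -> _ Rxb'; case: Nx; exists b'.
- by case: abE => _ ->; case: ab'E.
- exact: Rinj Rab Ra'b.
- by case: a'bE Rab => _ -> Ray; case: Ny; exists a.
- by case: abE Ra'b => _ -> Ra'y; case: Ny; exists a'.
- by case: abE => -> _; case: a'bE.
Qed.

Lemma no_injection_powerset (X : Type) (f : set X -> X) : ~ injective f.
Proof.
move=> finj; pose D := [set x | exists2 A, f A = x & ~ A x].
have ND : ~ D (f D) by move=> /[dup] DfD [A /finj ->].
by apply: (ND); exists D.
Qed.

Section Small.
Variable kappa : Type.
Hypothesis kappa_lim : strong_limit kappa.

Lemma smallPn (T : Type) (A : set T) :
  ~ small kappa A <-> exists2 f : kappa -> T, injective f & forall k, A (f k).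
Proof.
split=> [/contrapT/card_leP[f]|[f finj fA] sA].
  exists (fun k => val (f (to_setT k))); last by move=> k; apply: set_valP.
  move=> k k' /val_inj fE.
  have := 'inj_f; move=> /(_ (to_setT k) (to_setT k')).
  rewrite !inE => /(_ I I fE).
  by move=> /(congr1 val).
apply: sA; apply/card_leP.
have gP (k : [set: kappa]) : f (val k) \in A by rewrite inE; apply: fA.
pose g (k : [set: kappa]) : A := SigSub (gP k).
apply/injfunPex; exists g => // k k' _ _ /(congr1 val) /finj; exact: val_inj.
Qed.

Lemma small_inj (T U : Type) (A : set T) (B : set U) (f : T -> U) :
  (forall x, A x -> B (f x)) -> (forall x y, A x -> A y -> f x = f y -> x = y) ->
  small kappa B -> small kappa A.
Proof.
move=> fAB finj sB; apply: contrapT => /smallPn[g ginj gA].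
suff: ~ small kappa B by [].
apply/smallPn; exists (f \o g) => [k k' /= fg|k]; last exact/fAB.
exact/ginj/finj.
Qed.

Lemma small_sub (X : Type) (A B : set X) : A `<=` B -> small kappa B -> small kappa A.
Proof. by move=> AB; apply: (@small_inj _ _ _ _ id). Qed.

(** Kuratowski pairs embed the square into the double power set, so the strong limit hypothesis,
    used twice, suffices. *)
Lemma small_square (X : Type) : small kappa [set: X] -> small kappa [set: X * X].
Proof.
move=> sX; apply: (@small_inj _ _ _ _ (fun xy => [set [set xy.1]; [set xy.1; xy.2]])
  _ _ (kappa_lim (kappa_lim sX))) => // -[x y] [x' y'] _ _ /= E.
have [xx' yE] : x = x' /\ [set x; y] = [set x; y'].
  have : [set [set x]; [set x; y]] [set x] by left.
  have : [set [set x]; [set x; y]] [set x; y] by right.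
  rewrite E => xyE xE.
  have xx' : x = x'.
    have : [set x] x' by case: xE => ->; [|left].
    by [].
  split=> //; rewrite -xx' in E xyE; case: xyE => // yE.
  have : [set [set x]; [set x; y']] [set x; y'] by right.
  by rewrite -E yE => -[].
congr pair => //.
have : [set x; y'] y by rewrite -yE; right.
have : [set x; y] y' by rewrite yE; right.
by move=> [->|->] // [].
Qed.

Lemma small_prod (X Y : Type) : small kappa [set: X] -> small kappa [set: Y] ->
  small kappa [set: X * Y].
Proof.
move=> sX sY; have [[f finj]|[f finj]] := injection_total X Y.
  apply: (@small_inj _ _ _ _ (fun xy => (f xy.1, xy.2)) _ _ (small_square sY)) => //.
  by move=> [x y] [x' y'] _ _ /= [/finj -> ->].
apply: (@small_inj _ _ _ _ (fun xy => (xy.1, f xy.2)) _ _ (small_square sX)) => //.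
by move=> [x y] [x' y'] _ _ /= [-> /finj ->].
Qed.

Lemma small_fun (X Y : Type) : small kappa [set: X] -> small kappa [set: Y] ->
  small kappa [set: X -> Y].
Proof.
move=> sX sY; apply: (@small_inj _ _ _ _ (fun g => [set xy | g xy.1 = xy.2])
  _ _ (kappa_lim (small_prod sX sY))) => // g h _ _ E.
apply/funext => x; have : [set xy | g xy.1 = xy.2] (x, g x) by [].
by rewrite E.
Qed.

Lemma small_image (X U : Type) (f : X -> U) :
  small kappa [set: X] -> small kappa (range f).
Proof.
have [X0|NX sX] := pselect (exists x : X, True); last first.
  by apply: (@small_inj _ _ _ _ (fun _ => set0) _ _ (kappa_lim sX)) => //;
    move=> ? ? [x]; case: NX; exists x.
case: X0 => x0 _ sX.
have /choice[g gP] : forall u, exists x, range f u -> f x = u.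
  move=> u; have [[x _ <-]|Nu] := pselect (range f u); first by exists x.
  by exists x0.
apply: (@small_inj _ _ _ _ g _ _ sX) => // u v fu fv guv.
by rewrite -(gP u) // guv gP.
Qed.

Lemma small_sig (X : Type) (A : set X) : small kappa A -> small kappa [set: {x | A x}].
Proof.
move=> sA.
apply: (@small_inj _ _ _ _ sval _ _ sA) => [[]//|[x Ax] [y Ay] _ _ /=].
exact: eq_exist.
Qed.

Lemma small_setX (X Y : Type) (A : set X) (B : set Y) :
  small kappa A -> small kappa B -> small kappa (A `*` B).
Proof.
move=> /small_sig sA /small_sig sB.
pose f (t : {x | A x} * {y | B y}) := (sval t.1, sval t.2).
apply: small_sub (small_image (f := f) (small_prod sA sB)) => -[x y] [/= Ax By].
by exists (exist _ x Ax, exist _ y By).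
Qed.

Hypothesis small_nat : small kappa [set: nat].

Lemma small_setU (X : Type) (A B : set X) :
  small kappa A -> small kappa B -> small kappa (A `|` B).
Proof.
move=> sA sB.
have sA' := small_sig sA; have sB' := small_sig sB.
have [[a0 Aa0]|NA] := pselect (exists x, A x); last first.
  by apply: small_sub sB => x [Ax|//]; case: NA; exists x.
have [[b0 Bb0]|NB] := pselect (exists x, B x); last first.
  by apply: small_sub sA => x [//|Bx]; case: NB; exists x.
pose f (t : nat * ({x | A x} * {x | B x})) :=
  if t.1 is 0 then proj1_sig t.2.1 else proj1_sig t.2.2.
apply: small_sub (small_image (f := f) (small_prod small_nat (small_prod sA' sB'))).
move=> x [Ax|Bx].
  by exists (0%N, (exist _ x Ax, exist _ b0 Bb0)).
by exists (1%N, (exist _ a0 Aa0, exist _ x Bx)).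
Qed.

Lemma small_countable (X : countType) (A : set X) : small kappa A.
Proof.
by apply: (@small_inj _ _ _ _ pickle _ _ small_nat) => // x y _ _ /(pcan_inj pickleK).
Qed.

End Small.

(** * Definable sets and saturation in countably many variables *)

Section Renaming.
Variable L : language.

Fixpoint term_rename (k l : nat) (f : 'I_k -> 'I_l) (t : term L k) : term L l :=
  match t with
  | Var i => Var L (f i)
  | App g ts => App (fun i => term_rename f (ts i))
  end.

Definition rename_lift (k l : nat) (f : 'I_k -> 'I_l) (i : 'I_k.+1) : 'I_l.+1 :=
  if unlift ord0 i is Some j then lift ord0 (f j) else ord0.

Fixpoint rename (k : nat) (phi : formula L k) : forall l, ('I_k -> 'I_l) -> formula L l :=
  match phi in formula _ k return forall l, ('I_k -> 'I_l) -> formula L l with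
  | Eq _ t u => fun l f => Eq (term_rename f t) (term_rename f u)
  | Rel _ r ts => fun l f => Rel (fun i => term_rename f (ts i))
  | Bot _ => fun l _ => Bot L l
  | Imp _ phi psi => fun l f => Imp (rename phi f) (rename psi f)
  | All _ phi => fun l f => All (rename phi (rename_lift f))
  end.

Variable M : structure L.

Lemma eval_rename (k l : nat) (f : 'I_k -> 'I_l) (v : l.-tuple M) (t : term L k) :
  eval v (term_rename f t) = eval [tuple tnth v (f i) | i < k] t.
Proof.
elim: t => [i|g ts IH] /=; first by rewrite tnth_mktuple.
by congr finterp; apply: eq_mktuple => i; rewrite IH.
Qed.

Lemma sat_rename (k : nat) (phi : formula L k) : forall (l : nat) (f : 'I_k -> 'I_l)
  (v : l.-tuple M), sat (rename phi f) v <-> sat phi [tuple tnth v (f i) | i < k].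
Proof.
elim: phi => {k} [k t u|k r ts|k|k phi IHphi psi IHpsi|k phi IHphi] l f v /=.
- by rewrite !eval_rename.
- by under eq_mktuple do rewrite eval_rename.
- by [].
- by rewrite IHphi IHpsi.
have E (m : M) : [tuple tnth [tuple of m :: v] (rename_lift f i) | i < k.+1] =
          [tuple of m :: [tuple tnth v (f i) | i < k]].
  apply: eq_from_tnth => i; rewrite tnth_mktuple /rename_lift.
  case: (unliftP ord0 i) => [j ->|->]; last by rewrite !tnth0.
  by rewrite !tnthS tnth_mktuple.
by split=> H m; have := H m; rewrite IHphi E.
Qed.

End Renaming.

Section Definable.
Variables (L : language) (M : structure L).

Definition assign (X : Type) (v : X -> M) (s : X + M) : M :=
  match s with inl x => v x | inr a => a end.

(* Sets of valuations of an arbitrary family X of variables; sigma says which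
   variable or parameter from A stands for each free variable of phi. *)
Definition dfn (X : Type) (A : set M) (P : set (X -> M)) : Prop :=
  exists (k : nat) (phi : formula L k) (sigma : 'I_k -> X + M),
    (forall i a, sigma i = inr a -> A a) /\
    forall v, P v <-> sat phi [tuple assign v (sigma i) | i < k].

Section Closure.
Variables (X : eqType) (A : set M).
Implicit Types P Q : set (X -> M).

Lemma dfn_ext P Q : (forall v, P v <-> Q v) -> dfn A P -> dfn A Q.
Proof.
by move=> PQ [k [phi [s [sA sP]]]]; exists k, phi, s; split=> // v; rewrite -PQ.
Qed.

Lemma dfn_subset (B : set M) P : A `<=` B -> dfn A P -> dfn B P.
Proof.
by move=> AB [k [phi [s [sA sP]]]]; exists k, phi, s; split=> // i a /sA/AB.
Qed.

Lemma dfn_subst (Y : Type) (s : X -> Y + M) P :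
  (forall x a, s x = inr a -> A a) -> dfn A P ->
  dfn A (fun v : Y -> M => P (fun x => assign v (s x))).
Proof.
move=> sA [k [phi [t [tA tP]]]].
exists k, phi, (fun i => match t i with inl x => s x | inr a => inr a end); split.
  by move=> i a; case E : (t i) => [x|b]; [exact: sA|move=> [<-]; exact: tA E].
move=> v; rewrite tP; set T1 := (X in sat _ X); set T2 := (X in _ <-> sat _ X).
suff -> : T1 = T2 by [].
by apply: eq_mktuple => i; case: (t i).
Qed.

Lemma dfn_bot : dfn A (fun _ : X -> M => False).
Proof.
exists 0%N, (Bot L 0), (fun i : 'I_0 => False_rect _ (notF (ltn_ord i))).
by split=> [[]|].
Qed.

Lemma dfn_imp P Q : dfn A P -> dfn A Q -> dfn A (fun v => P v -> Q v).
Proof.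
move=> [k [phi [s [sA sP]]]] [l [psi [t [tA tP]]]].
exists (k + l)%N, (Imp (rename phi (lshift l)) (rename psi (@rshift k l))),
  (fun i => match fintype.split i with inl i => s i | inr j => t j end).
split=> [i a|v /=]; first by case: fintype.split => j; [apply: sA|apply: tA].
rewrite !sat_rename sP tP.
set a := (X in sat phi X -> _); set b := (X in _ -> sat psi X).
set a' := (X in _ <-> (sat phi X -> _)); set b' := (X in _ <-> (_ -> sat psi X)).
have -> : a' = a.
  by apply: eq_mktuple => i; rewrite tnth_mktuple (unsplitK (inl i)).
have -> // : b' = b.
by apply: eq_mktuple => i; rewrite tnth_mktuple (unsplitK (inr i)).
Qed.

Lemma dfn_not P : dfn A P -> dfn A (fun v => ~ P v).
Proof. by move=> dP; apply: dfn_imp dP dfn_bot. Qed.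

Lemma dfn_and P Q : dfn A P -> dfn A Q -> dfn A (fun v => P v /\ Q v).
Proof.
move=> dP dQ; apply: dfn_ext (dfn_not (dfn_imp dP (dfn_not dQ))) => v.
split=> [H|[Pv Qv] H]; last exact: H.
by split; apply: contrapT => N; apply: H => Pv Qv; apply: N.
Qed.

Lemma dfn_true : dfn A (fun _ : X -> M => True).
Proof. by apply: dfn_ext (dfn_not dfn_bot) => v; split=> // _ []. Qed.

Lemma dfn_eq (s t : X + M) : (forall a, s = inr a -> A a) ->
  (forall a, t = inr a -> A a) -> dfn A (fun v => assign v s = assign v t).
Proof.
move=> sA tA; exists 2%N, (Eq (Var L ord0) (Var L ord_max)),
  (fun i : 'I_2 => if i == ord0 then s else t); split.
  by move=> i a; case: ifP => _; [apply: sA|apply: tA].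
by move=> v /=; rewrite !tnth_mktuple.
Qed.

Definition upd (T : Type) (v : X -> T) x m := fun y => if y == x then m else v y.

Lemma dfn_all x P : dfn A P -> dfn A (fun v => forall m, P (upd v x m)).
Proof.
move=> [k [phi [s [sA sP]]]].
(* Several free variables of [phi] may stand for [x]; [f] merges them into the variable bound by
   [All] and shifts the others. *)
pose f (i : 'I_k) : 'I_k.+1 :=
  if s i is inl y then if y == x then ord0 else lift ord0 i else lift ord0 i.
have fE v m : [tuple assign (upd v x m) (s i) | i < k] =
    [tuple tnth [tuple of m :: [tuple assign v (s i) | i < k]] (f i) | i < k].
  apply: eq_mktuple => i; rewrite /f; case E : (s i) => [y|a] /=.
    by rewrite /upd; case: (y =P x) => _; rewrite ?tnth0 // tnthS tnth_mktuple E.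
  by rewrite tnthS tnth_mktuple E.
exists k, (All (rename phi f)), s; split=> // v /=.
by split=> H m; have := H m; rewrite sP sat_rename fE.
Qed.

Lemma dfn_ex x P : dfn A P -> dfn A (fun v => exists m, P (upd v x m)).
Proof.
move=> dP; apply: dfn_ext (dfn_not (dfn_all x (dfn_not dP))) => v.
by split=> [/existsNP[m /contrapT]|[m Pm] H]; [exists m|apply: H Pm].
Qed.

Lemma dfn_support P : dfn A P -> exists s : seq X,
  forall v w, {in s, v =1 w} -> P v -> P w.
Proof.
move=> [k [phi [t [tA tP]]]].
exists (pmap (fun i => if t i is inl x then Some x else None) (enum 'I_k)).
move=> v w vw; rewrite !tP.
suff -> : [tuple assign v (t i) | i < k] = [tuple assign w (t i) | i < k] by [].
apply: eq_mktuple => i; case E : (t i) => [x|a] //=; apply: vw.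
by rewrite mem_pmap; apply/mapP; exists i; rewrite ?mem_enum // E.
Qed.

Lemma dfn_ex_seq (s : seq X) P : dfn A P ->
  dfn A (fun v => exists v', (forall x, x \notin s -> v' x = v x) /\ P v').
Proof.
move=> dP; elim: s => [|x s IH].
  apply: dfn_ext dP => v; split=> [Pv|[v' [v'v Pv']]]; first by exists v.
  by suff -> : v = v' by []; apply/funext => y; rewrite v'v.
apply: dfn_ext (dfn_ex x IH) => v; split=> [[m [v' [v'P Pv']]]|[v' [v'P Pv']]].
  exists v'; split=> // y; rewrite inE negb_or => /andP[yx ys].
  by rewrite v'P // /upd (negPf yx).
exists (v' x), v'; split=> // y ys; rewrite /upd; case: eqP => [->//|/eqP yx].
by rewrite v'P // inE negb_or yx.
Qed.

(** Only the finitely many variables in a support of [P] matter, so quantifying over all variables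
    outside [S] amounts to finitely many quantifiers. *)
Lemma dfn_proj (S : set X) P : dfn A P ->
  dfn A (fun v => exists v', (forall x, S x -> v' x = v x) /\ P v').
Proof.
move=> dP; have [s sP] := dfn_support dP.
apply: dfn_ext (dfn_ex_seq [seq x <- s | ~~ `[< S x >]] dP) => v.
split=> -[v' [v'v Pv']].
  by exists v'; split=> // x Sx; apply: v'v; rewrite mem_filter; have /asboolT -> := Sx.
exists (fun x => if x \in [seq x <- s | ~~ `[< S x >]] then v' x else v x).
split=> [x /negPf -> //|]; apply: sP Pv' => x xs.
rewrite mem_filter xs andbT; case: asboolP => //= Sx; exact: v'v.
Qed.

End Closure.

Lemma dfn_pformula (A : set M) (a0 : M) (m : nat) (P : set ('I_m -> M)) :
  A a0 -> dfn A P -> exists f : pformula M m,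
    (forall i, A (tnth (param f) i)) /\ forall x, holds f x <-> P (tnth x).
Proof.
move=> Aa0 [k [phi [s [sA sP]]]].
(* Every free variable of [phi] gets a parameter slot; the slots of those standing for proper
   variables are filled by the dummy [a0]. *)
exists (@PFormula L M m k
  (rename phi (fun i => if s i is inl j then lshift k j else rshift m i))
  [tuple if s i is inr a then a else a0 | i < k]); split=> [i|x].
  by rewrite /= tnth_mktuple; case E : (s i) => [//|a]; apply: sA E.
rewrite /holds /= sat_rename sP.
set T1 := (X in sat _ X); set T2 := (X in _ <-> sat _ X).
suff -> : T1 = T2 by [].
apply: eq_mktuple => i; case E : (s i) => [j|a] /=; first by rewrite tnth_lshift.
by rewrite tnth_rshift tnth_mktuple E.
Qed.

Lemma pformula_dfn (X : Type) (A : set M) (m : nat) (f : pformula M m) (s : 'I_m -> X) :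
  (forall i, A (tnth (param f) i)) ->
  dfn A (fun v : X -> M => holds f [tuple v (s i) | i < m]).
Proof.
move=> fA; exists (m + nparam f)%N, (pform f), (fun i => match fintype.split i with
  inl j => inl (s j) | inr j => inr (tnth (param f) j) end); split.
  by move=> i a; case: fintype.split => // j [<-].
move=> v; rewrite /holds; set T1 := (X in sat _ X); set T2 := (X in _ <-> sat _ X).
suff -> : T1 = T2 by [].
apply: eq_from_tnth => i; rewrite tnth_mktuple.
case: (splitP i) => j ij; last first.
  have -> : i = rshift m j by apply/val_inj.
  by rewrite tnth_rshift.
have -> : i = lshift (nparam f) j by apply/val_inj.
by rewrite tnth_lshift tnth_mktuple.
Qed.

Definition directed (X : Type) (D : set (set X)) :=
  forall P Q, D P -> D Q -> exists2 R, D R & R `<=` P `&` Q.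

Lemma directed_seq (X : Type) (D : set (set X)) (P0 : set X) :
  D P0 -> directed D -> forall (T : eqType) (s : seq T) (Q : T -> set X),
  (forall t, t \in s -> D (Q t)) -> exists2 R, D R & forall t, t \in s -> R `<=` Q t.
Proof.
move=> DP0 dD T s Q; elim: s => [|t s IH] Ds; first by exists P0.
have [R DR RQ] := IH (fun t' t's => Ds t' (mem_behead (t's : t' \in behead (t :: s)))).
have [R' DR' sR'] := dD _ _ DR (Ds t (mem_head _ _)).
exists R' => // t'; rewrite inE => /predU1P[->|/RQ RQt'] x /sR'[//].
by move=> /RQt'.
Qed.

(** * Realizing directed families of definable sets *)

Section Saturation.
Variable kappa : Type.
Hypothesis satM : sufficiently_saturated M kappa.

Lemma saturation1 (A : set M) (a0 : M) (D : set (set ('I_1 -> M)))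
    (P0 : set ('I_1 -> M)) :
  small kappa A -> A a0 -> D P0 -> directed D ->
  (forall P, D P -> dfn A P) -> (forall P, D P -> exists v, P v) ->
  exists v, forall P, D P -> P v.
Proof.
move=> sA Aa0 DP0 dD dfnD neD.
pose q : set (pformula M 1) := [set f | (forall i, A (tnth (param f) i)) /\
  exists2 P, D P & forall x, holds f x <-> P (tnth x)].
have [|q0 q0q fq0|x xq] := kappa_saturated satM sA (q := q).
- by move=> f [].
- have [s sE] := (@finite_seqP {classic (pformula M 1)} q0).1 fq0.
  have /choice[Q QP] : forall f : {classic (pformula M 1)}, exists P, f \in s ->
      D P /\ forall x, holds f x <-> P (tnth x).
    move=> f; have [fs|_] := boolP (f \in s); last by exists P0.
    have : q0 f by rewrite sE.
    by move=> /q0q [_ [P DP PE]]; exists P.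
  have [R DR RQ] := @directed_seq _ D P0 DP0 dD _ s Q (fun t ts => (QP t ts).1).
  have [v Rv] := neD _ DR.
  exists [tuple v i | i < 1] => f; rewrite sE => /= fs; apply/(QP f fs).2.
  suff -> : tnth [tuple v i | i < 1] = v by apply: RQ Rv.
  by apply/funext => i; rewrite tnth_mktuple.
exists (tnth x) => P DP; have [f [fA fP]] := dfn_pformula Aa0 (dfnD _ DP).
by apply/fP/xq; split=> //; exists P.
Qed.

Variables (X : countType) (A : set M) (a0 : M).
Variables (D : set (set (X -> M))) (P0 : set (X -> M)).
Hypotheses (sA : small kappa A) (Aa0 : A a0) (DP0 : D P0) (dD : directed D).
Hypotheses (dfnD : forall P, D P -> dfn A P) (neD : forall P, D P -> exists v, P v).

Let consistent (k : nat) (w : X -> M) := forall P, D P ->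
  exists2 v, P v & forall x, (pickle x < k)%N -> v x = w x.

(** The value at the variable with code [k] is found by saturation in one variable, with the values
    of [w] as parameters. The hypothesis sits under the existential so that choice applies to all
    [k] and [w]. *)
Let consistent_step k w : exists w', consistent k w ->
  (forall x, (pickle x < k)%N -> w' x = w x) /\ consistent k.+1 w'.
Proof.
have [cw|Nw] := pselect (consistent k w); last by exists w.
have [[x0 x0k]|Nk] := pselect (exists x : X, pickle x = k); last first.
  exists w => _; split=> // P DP; have [v Pv vw] := cw P DP.
  exists v => // x; rewrite ltnS leq_eqVlt => /predU1P[xk|]; last exact: vw.
  by case: Nk; exists x.
(* [E P] holds the values at [x0] that, with the earlier values of [w], still extend to a point of
   [P]. *)
pose E P : set ('I_1 -> M) := fun m => exists v',
  (forall x, [set x : X | (pickle x < k.+1)%N] x ->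
     v' x = assign m (if x == x0 then inl ord0 else inr (w x))) /\ P v'.
have [||||||m mP] := @saturation1 (A `|` range w) a0 (E @` D) (E P0).
- apply: (small_setU (kappa_strong_limit satM) (small_nat satM)) => //.
  apply: (small_image (kappa_strong_limit satM)).
  exact: (small_countable (small_nat satM)).
- by left.
- by exists P0.
- move=> _ _ [P DP <-] [Q DQ <-]; have [R DR RPQ] := dD DP DQ.
  exists (E R); first by exists R.
  by move=> u [v [vE /RPQ[Pv Qv]]]; split; exists v.
- move=> _ [P DP <-].
  apply: (dfn_subst (P := fun v => exists v',
    (forall x, [set x : X | (pickle x < k.+1)%N] x -> v' x = v x) /\ P v')).
    by move=> x a; case: eqP => // _ [<-]; right; exists x.
  apply: dfn_proj; apply: dfn_subset (dfnD DP); exact: subsetUl.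
- move=> _ [P DP <-]; have [v Pv vw] := cw P DP.
  exists (fun _ => v x0), v; split=> // x /=; case: eqP => [->//|/= xx0].
  rewrite ltnS leq_eqVlt => /predU1P[xk|]; last exact: vw.
  by case: xx0; apply: (pcan_inj pickleK); rewrite xk.
exists (upd w x0 (m ord0)) => _; split.
  by move=> x xk; rewrite /upd; case: eqP => // xx0; rewrite xx0 x0k ltnn in xk.
move=> P DP; have [|v [vE Pv]] := mP (E P); first by exists P.
by exists v => // x /vE ->; rewrite /upd; case: eqP.
Qed.

(** Coordinates are fixed one at a time; each [P] has finite support, so it is already decided at a
    finite stage. *)
Lemma countable_saturation : exists v, forall P, D P -> P v.
Proof.
have /choice[next nextP] : forall kw : nat * (X -> M), exists w', consistent kw.1 kw.2 ->
  (forall x, (pickle x < kw.1)%N -> w' x = kw.2 x) /\ consistent kw.1.+1 w'.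
  by move=> [k w]; apply: consistent_step.
pose fix w k := if k is j.+1 then next (j, w j) else fun _ => a0.
have wP k : consistent k (w k).
  elim: k => [|k IH]; first by move=> P /neD[v Pv]; exists v.
  exact: (nextP (k, w k) IH).2.
have w_coh j k x : (pickle x < j <= k)%N -> w k x = w j x.
  move=> /andP[xj]; elim: k => [|k IH]; first by rewrite leqn0 => /eqP ->.
  rewrite leq_eqVlt => /predU1P[-> //|jk]; rewrite -IH //.
  by apply: (nextP (k, w k) (wP k)).1 => /=; exact: (leq_trans xj).
exists (fun x => w (pickle x).+1 x) => P DP.
have [s sP] := dfn_support (dfnD DP).
have [v Pv vw] := wP (\max_(x <- s) pickle x).+1 P DP.
apply: sP Pv => x xs; have xle : (pickle x < (\max_(x <- s) pickle x).+1)%N.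
  by rewrite ltnS; apply: leq_bigmax_seq.
by rewrite vw // (w_coh (pickle x).+1) // ltnSn.
Qed.

End Saturation.
End Definable.

(** * Sets definable relatively to the field *)

(** The parameter set is explicit here, so that a single one can serve the field, its addition and
    its multiplication. *)
Definition type_definable_over (L : language) (M : structure L) (A : set M) (m : nat)
    (D : set (m.-tuple M)) :=
  exists2 q : set (pformula M m), Defs.over A q & D = [set x | realizes x q].

Section RelativelyDefinable.
Variables (L : language) (M : structure L) (kappa : Type).
Hypothesis satM : sufficiently_saturated M kappa.
Variables (n : nat) (F : fieldType) (e : F -> n.-tuple M).
Hypothesis e_inj : injective e.

Notation X := (nat * 'I_n)%type.

Definition coords (u : nat -> F) (x : X) : M := tnth (e (u x.1)) x.2.

(* Variable k of a set of sequences in F stands for the block of variables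
   (k, i), i < n, of a formula. *)
Definition rel_dfn (B : set M) (R : set (nat -> F)) :=
  exists2 P : set (X -> M), dfn B P & forall u, R u <-> P (coords u).

(** An intersection of relatively definable sets, phrased pointwise: every sequence outside is
    excluded by one of them. *)
Definition rel_tdfn (B : set M) (R : set (nat -> F)) :=
  forall u, ~ R u -> exists Q, [/\ rel_dfn B Q, R `<=` Q & ~ Q u].

Lemma block_coords u k : [tuple coords u (k, i) | i < n] = e (u k).
Proof. by apply: eq_from_tnth => i; rewrite tnth_mktuple. Qed.

Section Closure.
Variable B : set M.

Lemma rel_dfn_ext R S : (forall u, R u <-> S u) -> rel_dfn B R -> rel_dfn B S.
Proof. by move=> RS [P dP PE]; exists P => // u; rewrite -RS. Qed.

Lemma rel_dfn_not R : rel_dfn B R -> rel_dfn B (fun u => ~ R u).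
Proof.
by move=> [P dP PE]; exists (fun v => ~ P v) => [|u]; [exact: dfn_not|rewrite PE].
Qed.

Lemma rel_dfn_and R S : rel_dfn B R -> rel_dfn B S -> rel_dfn B (fun u => R u /\ S u).
Proof.
move=> [P dP PE] [Q dQ QE]; exists (fun v => P v /\ Q v); first exact: dfn_and.
by move=> u; rewrite PE QE.
Qed.

Lemma rel_dfn_true : rel_dfn B (fun _ => True).
Proof. by exists (fun _ => True) => //; exact: dfn_true. Qed.

Lemma rel_dfn_forall_seq (T : eqType) (s : seq T) (R : T -> set (nat -> F)) :
  (forall t, t \in s -> rel_dfn B (R t)) ->
  rel_dfn B (fun u => forall t, t \in s -> R t u).
Proof.
elim: s => [|t s IH] dR; first by apply: rel_dfn_ext rel_dfn_true.
have dRs : rel_dfn B (fun u => forall t, t \in s -> R t u).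
  by apply: IH => t' t's; apply: dR; rewrite inE t's orbT.
apply: rel_dfn_ext (rel_dfn_and (dR t (mem_head _ _)) dRs) => u.
split=> [[Rt Rs] t'|H]; first by rewrite inE => /predU1P[->|/Rs].
by split=> [|t' t's]; apply: H; rewrite inE ?eqxx ?t's ?orbT.
Qed.

Lemma rel_dfn_subst (s : nat -> nat) R :
  rel_dfn B R -> rel_dfn B (fun u => R (fun k => u (s k))).
Proof.
move=> [P dP PE].
exists (fun v => P (fun x => assign v (inl (s x.1, x.2)))); first exact: dfn_subst.
by move=> u; rewrite PE.
Qed.

Lemma rel_dfn_coord (k : nat) (i : 'I_n) (t : X + M) : (forall a, t = inr a -> B a) ->
  rel_dfn B (fun u => tnth (e (u k)) i = assign (coords u) t).
Proof.
move=> tB; exists (fun v => assign v (inl (k, i)) = assign v t) => //.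
exact: dfn_eq.
Qed.

Lemma rel_dfn_eq (k l : nat) : rel_dfn B (fun u => u k = u l).
Proof.
apply: rel_dfn_ext (rel_dfn_forall_seq (s := enum 'I_n)
  (R := fun i u => tnth (e (u k)) i = tnth (e (u l)) i) _) => [u|i _].
  split=> [H|-> //]; apply/e_inj/eq_from_tnth => i; apply: H; exact: mem_enum.
by apply: (@rel_dfn_coord k i (inl (l, i))).
Qed.

Lemma rel_dfn_eq_param (k : nat) (x : F) : (forall i, B (tnth (e x) i)) ->
  rel_dfn B (fun u => u k = x).
Proof.
move=> Bx.
apply: rel_dfn_ext (rel_dfn_forall_seq (s := enum 'I_n)
  (R := fun i u => tnth (e (u k)) i = tnth (e x) i) _) => [u|i _].
  split=> [H|-> //]; apply/e_inj/eq_from_tnth => i; apply: H; exact: mem_enum.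
by apply: (@rel_dfn_coord k i (inr (tnth (e x) i))) => _ [<-].
Qed.

Lemma rel_dfn_tdfn R : rel_dfn B R -> rel_tdfn B R.
Proof. by move=> dR u NRu; exists R; split. Qed.

Lemma rel_tdfn_ext R S : (forall u, R u <-> S u) -> rel_tdfn B R -> rel_tdfn B S.
Proof.
move=> RS tR u NSu; have [|Q [dQ RQ NQ]] := tR u; first by rewrite RS.
by exists Q; split=> // u' /RS /RQ.
Qed.

Lemma rel_tdfn_and R S : rel_tdfn B R -> rel_tdfn B S -> rel_tdfn B (fun u => R u /\ S u).
Proof.
move=> tR tS u; have [Ru|NR] := pselect (R u) => NRS.
  have [|Q [dQ SQ NQ]] := tS u; first by move=> Su; exact: NRS.
  by exists Q; split=> // u' [_ /SQ].
by have [Q [dQ RQ NQ]] := tR u NR; exists Q; split=> // u' [/RQ].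
Qed.

Lemma rel_tdfn_subst (s : nat -> nat) R :
  rel_tdfn B R -> rel_tdfn B (fun u => R (fun k => u (s k))).
Proof.
move=> tR u /tR[Q [dQ RQ NQ]]; exists (fun u => Q (fun k => u (s k))).
by split=> //; [exact: rel_dfn_subst|move=> u' /RQ].
Qed.

End Closure.

Lemma rel_dfn_subset (B C : set M) R : B `<=` C -> rel_dfn B R -> rel_dfn C R.
Proof. by move=> BC [P dP PE]; exists P => //; apply: dfn_subset dP. Qed.

Lemma rel_tdfn_type_definable (B : set M) (m : nat) (D : set (m.-tuple M))
    (s : 'I_m -> X) (R : set (nat -> F)) : type_definable_over B D ->
  (forall u, R u <-> D [tuple coords u (s i) | i < m]) -> rel_tdfn B R.
Proof.
move=> [q qB DE] RD u; rewrite RD DE => /existsNP[f /not_implyP[qf Nf]].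
exists (fun u => holds f [tuple coords u (s i) | i < m]); split=> //.
  exists (fun v => holds f [tuple v (s i) | i < m]) => //.
  by apply: pformula_dfn => i; apply: qB.
by move=> u'; rewrite RD DE; apply.
Qed.

Lemma rel_tdfn_ternary (B : set M) (op : F -> F -> F) (i j k : nat) :
  type_definable_over B
    [set t | exists x y : F, t = [tuple of (e x ++ e y) ++ e (op x y)]] ->
  rel_tdfn B (fun u => u k = op (u i) (u j)).
Proof.
move=> tdop; pose s (l : 'I_(n + n + n)) : X :=
  match fintype.split l with
  | inl l' => match fintype.split l' with inl a => (i, a) | inr b => (j, b) end
  | inr c => (k, c)
  end.
apply: (@rel_tdfn_type_definable B _ _ s _ tdop) => u.
have -> : [tuple coords u (s l) | l < n + n + n] =
          [tuple of (e (u i) ++ e (u j)) ++ e (u k)].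
  apply: eq_from_tnth => l; rewrite tnth_mktuple /s.
  case: (split_ordP l) => [l' ->|c ->]; last by rewrite tnth_rshift.
  rewrite tnth_lshift; case: (split_ordP l') => [a ->|b ->].
    by rewrite tnth_lshift.
  by rewrite tnth_rshift.
split=> [->|[x [y E]]]; first by exists (u i), (u j).
have E' l := congr1 (fun t => tnth t l) E.
have -> : u i = x.
  apply/e_inj/eq_from_tnth => a; have := E' (lshift n (lshift n a)).
  by rewrite !tnth_lshift.
have -> : u j = y.
  apply/e_inj/eq_from_tnth => b; have := E' (lshift n (rshift n b)).
  by rewrite !tnth_lshift !tnth_rshift.
apply/e_inj/eq_from_tnth => c; have := E' (rshift (n + n) c).
by rewrite !tnth_rshift.
Qed.

(** * Compactness for sequences in the field *)

Variables (A : set M) (a0 : M).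
Hypotheses (sA : small kappa A) (Aa0 : A a0).
Hypothesis tdK : type_definable_over A (range e).

(** The type defining [range e], read on any block of variables, consists of conditions true at
    every [coords u]; so each block of [v] codes a field element. *)
Lemma rel_points (B : set M) (v : X -> M) : A `<=` B ->
  (forall P, dfn B P -> (forall u, P (coords u)) -> P v) -> exists u, v = coords u.
Proof.
move=> AB vP; have [q qA qE] := tdK.
have /choice[u uE] : forall k, exists x, e x = [tuple v (k, i) | i < n].
  move=> k; suff: range e [tuple v (k, i) | i < n] by case=> x _ <-; exists x.
  rewrite qE => f qf.
  apply: (vP (fun v => holds f [tuple v (k, i) | i < n])).
    by apply: pformula_dfn => i; apply/AB/qA.
  move=> u; rewrite block_coords; suff: [set x | realizes x q] (e (u k)) by apply.
  by rewrite -qE; exists (u k).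
by exists u; apply/funext => -[k i]; rewrite /coords /= uE tnth_mktuple.
Qed.

(** [D'] collects the definable consequences of members of [D]. It includes those true on all of the
    field, so a realization comes from a sequence in [F], and relative type-definability puts it
    into each [R]. *)
Lemma rel_saturation (B : set M) (D : set (set (nat -> F))) (R0 : set (nat -> F)) :
  small kappa B -> A `<=` B -> D R0 -> directed D ->
  (forall R, D R -> rel_tdfn B R) -> (forall R, D R -> exists u, R u) ->
  exists u, forall R, D R -> R u.
Proof.
move=> sB AB DR0 dD tD neD.
pose D' : set (set (X -> M)) :=
  [set P | dfn B P /\ exists2 R, D R & forall u, R u -> P (coords u)].
have [||||||v vP] := @countable_saturation L M kappa satM X B a0 D' (fun _ => True).
- by [].
- exact: AB.
- by split; [exact: dfn_true|exists R0].
- move=> P Q [dP [R DR RP]] [dQ [S DS SQ]]; have [T DT TRS] := dD _ _ DR DS.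
  exists (fun v => P v /\ Q v) => //; split; first exact: dfn_and.
  by exists T => // u /TRS[/RP ? /SQ].
- by move=> P [].
- by move=> P [_ [R /neD[u Ru] RP]]; exists (coords u); apply: RP.
have [|u uv] := @rel_points B v AB.
  by move=> P dP PT; apply: vP; split=> //; exists R0.
exists u => R DR; apply: contrapT => /(tD _ DR)[Q [[P dP QP] RQ NQ]].
apply: NQ; rewrite QP -uv; apply: vP; split=> //.
by exists R => // u' /RQ/QP.
Qed.

(** A point [u] that no relatively definable set separates from the projection lies in it: the
    values of [u] become parameters, and saturation yields a sequence in [R] that agrees with [u] on
    [S]. *)
Lemma rel_tdfn_proj (S : set nat) (R : set (nat -> F)) : rel_tdfn A R ->
  rel_tdfn A (fun u => exists u', (forall k, S k -> u' k = u k) /\ R u').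
Proof.
move=> tR u NRu; apply: contrapT => Nsep; apply: NRu.
have sep Q : rel_dfn A Q ->
    (forall u u', (forall k, S k -> u' k = u k) -> R u' -> Q u) -> Q u.
  move=> dQ RQ; apply: contrapT => NQ; apply: Nsep; exists Q; split=> //.
  by move=> w [w' [w'w Rw']]; apply: RQ Rw'.
pose B := A `|` range (coords u).
(* These are the sets over [B] implied by agreement with [u] on [S] together with some [P1] that is
   definable over [A] and contains [R]. *)
pose D' : set (set (X -> M)) := [set P | dfn B P /\ exists P1, [/\ dfn A P1,
  forall u', R u' -> P1 (coords u') &
  forall v, P1 v -> (forall x : X, S x.1 -> v x = coords u x) -> P v]].
have [||||||v vP] := @countable_saturation L M kappa satM X B a0 D' (fun _ => True).
- apply: (small_setU (kappa_strong_limit satM) (small_nat satM)) => //.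
  apply: (small_image (kappa_strong_limit satM)).
  exact: (small_countable (small_nat satM)).
- by left.
- by split; [exact: dfn_true|exists (fun _ => True); split=> //; exact: dfn_true].
- move=> P Q [dP [P1 [dP1 RP1 P1P]]] [dQ [Q1 [dQ1 RQ1 Q1Q]]].
  exists (fun v => P v /\ Q v) => //; split; first exact: dfn_and.
  exists (fun v => P1 v /\ Q1 v); split; first exact: dfn_and.
    by move=> u' Ru'; split; [apply: RP1|apply: RQ1].
  by move=> w [P1w Q1w] wu; split; [apply: P1P|apply: Q1Q].
- by move=> P [].
- move=> P [_ [P1 [dP1 RP1 P1P]]].
  have [|w1 w2 w2w1 Rw2|v [vu P1v]] := sep (fun u => exists v,
    (forall x : X, S x.1 -> v x = coords u x) /\ P1 v).
  + eexists; first exact: (dfn_proj [set x : X | S x.1] dP1).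
    by move=> w.
  + exists (coords w2); split; last exact: RP1.
    by move=> x Sx; rewrite /coords w2w1.
  + by exists v; apply: P1P.
have [|u' u'v] := @rel_points A v (@subset_refl _ _).
  move=> P dP PT; apply: vP; split; last by exists P.
  by apply: dfn_subset dP; exact: subsetUl.
exists u'; split=> [k Sk|].
  apply/e_inj/eq_from_tnth => i.
  have := vP (fun v => assign v (inl (k, i)) = assign v (inr (coords u (k, i)))).
  rewrite u'v; apply; split.
    by apply: dfn_eq => // _ [<-]; right; exists (k, i).
  exists (fun _ => True); split=> //; first exact: dfn_true.
  by move=> w _; apply.
apply: contrapT => /tR[Q [[P dP QP] RQ NQ]].
apply: NQ; rewrite QP -u'v; apply: vP; split.
  by apply: dfn_subset dP; exact: subsetUl.
by exists P; split=> // w /RQ/QP.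
Qed.

(** Were [F] small, its elements could all serve as parameters, and the condition of differing from
    each of them, finitely satisfiable in an infinite field, would be realized in [F]. *)
Lemma infinite_field_large : infinite_set [set: F] -> ~ small kappa [set: F].
Proof.
move=> infF sF.
pose B := A `|` range (fun xi : F * 'I_n => tnth (e xi.1) xi.2).
have sB : small kappa B.
  apply: (small_setU (kappa_strong_limit satM) (small_nat satM)) => //.
  apply: (small_image (kappa_strong_limit satM)).
  apply: (small_prod (kappa_strong_limit satM)) => //.
  exact: (small_countable (small_nat satM)).
pose avoid (s : seq F) (u : nat -> F) := forall x, x \in s -> u 0%N <> x.
have [||||u uP] := @rel_saturation B (range avoid) (avoid [::]) sB (@subsetUl _ _ _).
- by exists [::].
- move=> _ _ [s _ <-] [t _ <-]; exists (avoid (s ++ t)); first by exists (s ++ t).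
  by move=> u us; split=> x xs; apply: us; rewrite mem_cat xs ?orbT.
- move=> _ [s _ <-]; apply/rel_dfn_tdfn/rel_dfn_forall_seq => x _.
  apply/rel_dfn_not/rel_dfn_eq_param => i; right; exists (x, i) => //.
- move=> _ [s _ <-].
  have [[x xs]|Ns] := pselect (exists x, x \notin s).
    by exists (fun _ => x) => y ys xy; rewrite xy ys in xs.
  case: infF; apply: sub_finite_set (finite_seq s) => x _ /=.
  by apply/negPn/negP => xs; apply: Ns; exists x.
have := uP (avoid [:: u 0%N]) (ex_intro2 _ _ [:: u 0%N] I erefl).
by move=> /(_ (u 0%N) (mem_head _ _)).
Qed.

(** Otherwise [S] meets every relatively definable [Q] containing [R]; by compactness some point of
    [S] lies in all such [Q], hence in [R]. *)
Lemma rel_tdfn_separation (R S : set (nat -> F)) :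
  rel_tdfn A R -> rel_tdfn A S -> (forall u, R u -> ~ S u) ->
  exists Q, [/\ rel_dfn A Q, R `<=` Q & forall u, Q u -> ~ S u].
Proof.
move=> tR tS RS; apply: contrapT => Nsep.
pose D := [set (fun u => Q u /\ S u) | Q in [set Q | rel_dfn A Q /\ R `<=` Q]].
have [|||||u uP] := @rel_saturation A D (fun u => True /\ S u) sA.
- by [].
- by exists (fun=> True) => //; split=> //; exact: rel_dfn_true.
- move=> _ _ [P [dP RP] <-] [Q [dQ RQ] <-].
  exists (fun u => (P u /\ Q u) /\ S u); last by move=> u [[]].
  exists (fun u => P u /\ Q u) => //.
  by split; [exact: rel_dfn_and|move=> u /[dup]/RP ? /RQ].
- by move=> _ [Q [dQ _] <-]; apply: rel_tdfn_and => //; exact: rel_dfn_tdfn.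
- move=> _ [Q [dQ RQ] <-]; apply: contrapT => NQ; apply: Nsep; exists Q.
  split=> // u Qu Su.
  by apply: NQ; exists u.
have Ru : R u.
  apply: contrapT => /tR[Q [dQ RQ NQ]]; apply: NQ.
  by have [] := uP _ (ex_intro2 _ _ Q (conj dQ RQ) erefl).
apply: (RS u Ru).
by have [] := uP _ (ex_intro2 _ _ (fun=> True) (conj (rel_dfn_true _) (fun _ _ => I)) erefl).
Qed.

(** The formulas over [A] true on the image of [H] define it: among them is the type of the field,
    and a point outside [H] violates one of them. *)
Lemma type_definable_image (H : set F) :
  rel_tdfn A (fun u => H (u 0%N)) -> type_definable kappa (e @` H).
Proof.
move=> tH; exists A, [set f : pformula M n | (forall i, A (tnth (param f) i)) /\
  forall x, H x -> holds f (e x)]; split=> //; first by move=> f [].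
apply/seteqP; split=> [_ [x Hx <-] f [_]|t tq]; first exact.
have [q qA qE] := tdK.
have [x _ xt] : range e t.
  rewrite qE => f qf; apply: tq; split=> [i|x _]; first exact: qA.
  suff: [set x | realizes x q] (e x) by apply.
  by rewrite -qE; exists x.
exists x => //; apply: contrapT => NHx.
(* Constant sequences turn a condition on sequences into one on single elements. *)
have [Q [[P dP QP] HQ NQ]] := tH (fun=> x) NHx.
have [] := @dfn_pformula L M A a0 n (fun w => P (fun y => assign w (inl y.2))) Aa0.
  exact: (dfn_subst (s := fun y : X => inl y.2)).
move=> f [fA fP]; apply: NQ; apply/QP.
have /fP : holds f t.
  by apply: tq; split=> // y Hy; apply/fP/(QP (fun=> y))/HQ.
by rewrite -xt.
Qed.

Lemma rel_dfn_fix (B : set M) (Q : F -> F -> Prop) (x : F) :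
  (forall i, B (tnth (e x) i)) -> rel_dfn B (fun u => Q (u 0%N) (u 1%N)) ->
  rel_dfn B (fun u => Q x (u 0%N)).
Proof.
move=> Bx [P dP QP]; exists (fun v => P (fun y => assign v
    (if y.1 == 0%N then inr (tnth (e x) y.2) else inl (0%N, y.2)))).
  by apply: dfn_subst dP => y a; case: ifP => // _ [<-].
move=> u; rewrite (QP (fun k => if k == 0%N then x else u 0%N)).
suff -> : coords (fun k => if k == 0%N then x else u 0%N) = (fun y => assign (coords u)
    (if y.1 == 0%N then inr (tnth (e x) y.2) else inl (0%N, y.2))) by [].
by apply/funext => -[k i]; rewrite /coords /=; case: eqP.
Qed.

Lemma rel_dfn_iff (B : set M) R (b : Prop) : rel_dfn B R -> rel_dfn B (fun u => R u <-> b).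
Proof.
move=> dR; have [bT|bF] := pselect b.
  by apply: rel_dfn_ext dR => u; split=> [|->].
by apply: rel_dfn_ext (rel_dfn_not dR) => u; split=> [|-> /bF].
Qed.

(** * From finite independence patterns to a failure of NIP *)

Section Independence.
Variable Q : F -> F -> Prop.
Hypothesis dQ : rel_dfn A (fun u => Q (u 0%N) (u 1%N)).
Hypothesis finite_IP : forall N : nat, exists (a : nat -> F) (b : set nat -> F),
  forall i I, (i < N)%N -> (Q (a i) (b I) <-> I i).

(** Compactness is used twice: first for all [a i] together with a witness for each finite set of
    naturals, then over the [a i] for an arbitrary set, whose finite parts already have
    witnesses. *)
Lemma rel_independence : exists (a : nat -> F) (b : set nat -> F),
  forall i I, Q (a i) (b I) <-> I i.
Proof.
(* [fin c] is the finite set with code [c]; even variables stand for the [a i], odd ones for the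
   witnesses of the sets [fin c]. *)
pose fin (c : nat) : set nat :=
  [set i | i \in odflt [::] (unpickle c : option (seq nat))].
pose E N (u : nat -> F) := forall t : nat * nat,
  t \in [seq (i, c) | i <- iota 0 N, c <- iota 0 N] ->
  (Q (u t.1.*2) (u t.2.*2.+1) <-> fin t.2 t.1).
have [|||||u uP] := @rel_saturation A (range E) (E 0%N) sA.
- by [].
- by exists 0%N.
- move=> _ _ [N _ <-] [N' _ <-]; exists (E (maxn N N')); first by exists (maxn N N').
  move=> u uE; split=> t /allpairsP[[i c]] /= [iN cN ->]; apply: uE;
    apply/allpairsP; exists (i, c); split=> //=; move: iN cN; rewrite !mem_iota /= !add0n;
    by move=> iN cN; rewrite leq_max ?iN ?cN ?orbT.
- move=> _ [N _ <-]; apply/rel_dfn_tdfn/rel_dfn_forall_seq => t _; apply: rel_dfn_iff.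
  exact: (rel_dfn_subst (fun k => if k == 0%N then t.1.*2 else t.2.*2.+1) dQ).
- move=> _ [N _ <-]; have [a [b abP]] := finite_IP N.
  exists (fun k => if odd k then b (fin k./2) else a k./2).
  move=> t /allpairsP[[i c]] /= [iN cN ->] /=; rewrite !odd_double /=.
  rewrite uphalf_double doubleK abP //; move: iN; rewrite mem_iota add0n.
  by [].
have {}uP i c : Q (u i.*2) (u c.*2.+1) <-> fin c i.
  have := uP (E (maxn i c).+1) (ex_intro2 _ _ _ I erefl) (i, c); apply.
  apply/allpairsP; exists (i, c); split=> //; rewrite mem_iota add0n ltnS /=;
    by rewrite ?leq_maxl ?leq_maxr.
exists (fun i => u i.*2).
suff /choice[b bP] : forall I : set nat, exists y, forall i, Q (u i.*2) y <-> I i.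
  by exists b => i I.
move=> I; pose B := A `|` range (coords u).
pose E' N (w : nat -> F) := forall i, i \in iota 0 N -> (Q (u i.*2) (w 0%N) <-> I i).
have [||||||w wP] := @rel_saturation B (range E') (E' 0%N).
- apply: (small_setU (kappa_strong_limit satM) (small_nat satM)) => //.
  apply: (small_image (kappa_strong_limit satM)).
  exact: (small_countable (small_nat satM)).
- exact: subsetUl.
- by exists 0%N.
- move=> _ _ [N _ <-] [N' _ <-]; exists (E' (maxn N N')); first by exists (maxn N N').
  move=> w wE; split=> i iN; apply: wE; move: iN; rewrite !mem_iota !add0n /= leq_max => ->;
    by rewrite ?orbT.
- move=> _ [N _ <-]; apply/rel_dfn_tdfn/rel_dfn_forall_seq => i _; apply: rel_dfn_iff.
  apply: rel_dfn_fix; first by move=> j; right; exists (i.*2, j).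
  by apply: rel_dfn_subset dQ; exact: subsetUl.
- move=> _ [N _ <-].
  exists (fun=> u (pickle [seq i <- iota 0 N | `[< I i >]]).*2.+1) => i iN.
  rewrite uP /fin /mkset pickleK mem_filter iN andbT.
  by split=> /asboolP.
exists (w 0%N) => i; have := wP (E' i.+1) (ex_intro2 _ _ _ Logic.I erefl) i; apply.
by rewrite mem_iota add0n /= ltnSn.
Qed.

Lemma rel_independence_not_NIP (T : theory L) : model T M -> ~ NIP T.
Proof.
move=> TM; apply; have [a [b abP]] := rel_independence.
have [P dP QP] := dQ.
pose s (y : X) : 'I_(n + n) + M :=
  inl (if y.1 == 0%N then lshift n y.2 else rshift n y.2).
have [] := @dfn_pformula L M A a0 (n + n) (fun w => P (fun y => assign w (s y))) Aa0.
  exact: (dfn_subst (s := s)).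
move=> f [fA fP].
(* The parameters of [f] are moved into the second tuple of variables, since [NIP] speaks of
   formulas without parameters. *)
exists n, (n + nparam f)%N,
  (rename (pform f) (cast_ord (esym (addnA n n (nparam f))))), M.
split=> //; exists (fun i => e (a i)), (fun I => [tuple of e (b I) ++ param f]) => i I.
rewrite sat_rename -(abP i I).
set t := [tuple of e (a i) ++ e (b I)].
suff -> : [tuple tnth [tuple of e (a i) ++ [tuple of e (b I) ++ param f]]
    (cast_ord (esym (addnA n n (nparam f))) l) | l < n + n + nparam f] =
    [tuple of t ++ param f].
  rewrite -/(holds f t) fP (QP (fun k => if k == 0%N then a i else b I)).
  suff -> : coords (fun k => if k == 0%N then a i else b I) =
      fun y => assign (tnth t) (s y) by [].
  apply/funext => -[k j]; rewrite /coords /=; case: eqP => _.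
    by rewrite tnth_lshift.
  by rewrite tnth_rshift.
apply: eq_from_tnth => l; rewrite tnth_mktuple.
pose x0 := tnth [tuple of t ++ param f] l.
by rewrite !(tnth_nth x0) /= catA.
Qed.

End Independence.

End RelativelyDefinable.

(** * Subgroups of bounded index *)

(** Zorn gives a maximal [r]-separated subset [C] of [G]. Either [nu] embeds into [C], or [C] embeds
    into [nu] and an element of [G] is coded by some point of [C] related to it. *)
Lemma separated_or_covered (T nu : Type) (t0 : nu) (G : set T) (r : T -> T -> Prop) :
  (forall x, r x x) -> (forall x y, r x y -> r y x) ->
  (exists2 c : nu -> T, forall w, G (c w) & forall w w', w <> w' -> ~ r (c w) (c w')) \/
  (exists g : T -> nu, forall x y, G x -> G y -> g x = g y -> exists2 z, r x z & r y z).
Proof.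
move=> rxx rC.
pose P (C : set T) := C `<=` G /\ forall x y, C x -> C y -> x <> y -> ~ r x y.
have [D DP totD|C [[CG Csep] Cmax]] := @Zorn_bigcup _ P.
  split=> [x [C DC Cx]|x y [C DC Cx] [C' DC' C'y]]; first exact: (DP _ DC).1.
  have [CC'|C'C] := totD _ _ DC DC'.
    by apply: (DP _ DC').2 => //; exact: CC'.
  by apply: (DP _ DC).2 => //; exact: C'C.
have near x : G x -> exists z : {z | C z}, r x (sval z).
  move=> Gx; apply: contrapT => Nz.
  have Nz' z : C z -> ~ r x z by move=> Cz rxz; apply: Nz; exists (exist _ z Cz).
  apply: (Cmax (C `|` [set x])).
    rewrite properEneq; split; last by move=> z; left.
    by apply/eqP => E; apply: (Nz' x) => //; rewrite E; right.
  split=> [z [/CG //|-> //]|y z [Cy|->] [Cz|->] yz //].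
  - exact: Csep.
  - by move=> /rC; exact: Nz'.
  - exact: Nz'.
have [[f finj]|[f finj]] := injection_total nu {z | C z}.
  left; exists (fun w => sval (f w)) => [w|w w' ww']; first exact/CG/(svalP (f w)).
  apply: Csep; [exact: svalP|exact: svalP|] => fE; apply/ww'/finj.
  by case: (f w) (f w') fE => [z Cz] [z' Cz'] /= zz'; exact: eq_exist.
right.
have /choice[g gP] : forall x, exists t, G x -> exists2 z, r x (sval z) & f z = t.
  move=> x; have [Gx|NG] := pselect (G x); last by exists t0.
  by have [z rxz] := near x Gx; exists (f z) => _; exists z.
exists g => x y Gx Gy gxy; have [z rxz fz] := gP x Gx; have [z' ryz' fz'] := gP y Gy.
have zz' : z = z' by apply: finj; rewrite fz fz'.
by exists (sval z); rewrite // zz'.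
Qed.

Section BoundedIndex.
Variable kappa : Type.
Hypothesis kappa_lim : strong_limit kappa.
Hypothesis small_nat : small kappa [set: nat].
Variables (F : fieldType) (H : set F) (G : nat -> set F).
Hypotheses (H0 : H 0) (HB : forall x y, H x -> H y -> H (x - y)).
Hypothesis HG : forall k, H `<=` G k.
Hypothesis GB : forall k x y, G k.+1 x -> G k.+1 y -> G k (x - y).
Hypothesis Gsep : forall x, x != 0 -> exists a k, ~ G k (a * x).
Hypothesis bounded : small kappa (cosets [set: F] H).
Hypothesis largeF : ~ small kappa [set: F].

Let HN x : H x -> H (- x). Proof. by rewrite -sub0r; exact: HB. Qed.
Let HD x y : H x -> H y -> H (x + y).
Proof. by move=> Hx /HN; rewrite -{2}[y]opprK; exact: HB. Qed.

Let Q := {c : set F | cosets [set: F] H c}.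
Let coset (x : F) : Q := exist _ [set x + h | h in H] (ex_intro2 _ _ x I erefl).

Let coset_eq x y : coset x = coset y -> H (x - y).
Proof.
move=> /(congr1 sval)/= E.
have : [set x + h | h in H] x by exists 0; rewrite ?addr0.
by rewrite E => -[h Hh <-]; rewrite addrAC subrr add0r.
Qed.

Let smallQ : small kappa [set: Q].
Proof.
exact: small_sig.
Qed.

(** Being a power set, [nu] has no injection into the sequences of cosets; it is still smaller than
    [kappa]. *)
Let nu := set (nat -> Q).
(** Indexes countably many blocks of multipliers, with one multiplier in each block for every pair
    from [nu]. *)
Let Z := (nat * (nu * nu))%type.

Let small_nu : small kappa [set: nu].
Proof. by apply: kappa_lim; apply: small_fun. Qed.

Let smallZ : small kappa [set: Z].
Proof. by do 2! [apply: small_prod => //]. Qed.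

Let near k x y := forall a, G k (a * (x - y)).

Definition big_separated (k : nat) (f : Z -> F) := exists2 c : nu -> F,
  forall w z, H (f z * c w) & forall w w', w <> w' -> ~ near k (c w) (c w').

Let near_refl k x : near k x x.
Proof. by move=> a; rewrite subrr mulr0; exact: HG. Qed.

Let near_sym k x y : near k x y -> near k y x.
Proof. by move=> xy a; rewrite -opprB mulrN -mulNr; exact: xy. Qed.

(* If every k had a counterexample f_k, the subgroup of the x with
   f_k z * x in H for all k and z would still have bounded index, while its
   elements would be coded by fewer than kappa sequences in nu. *)
Lemma uniform_big_separated : exists k, forall f, big_separated k f.
Proof.
apply: contrapT => Nk; apply: largeF.
have /choice[f fP] : forall k, exists f, ~ big_separated k f.
  move=> k; apply: contrapT => Nf; apply: Nk; exists k => f.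
  by apply: contrapT => Nb; apply: Nf; exists f.
pose GA : set F := [set x | forall k z, H (f k z * x)].
have /choice[g gP] : forall k, exists g : F -> nu, forall x y, GA x -> GA y ->
    g x = g y -> exists2 z, near k x z & near k y z.
  move=> k; have [//||[c cG cS]|//] := @separated_or_covered F nu set0 GA (near k).
    exact: near_sym.
  by case: (fP k); exists c => [w z|//]; exact: cG.
pose col x (kz : nat * Z) := coset (f kz.1 kz.2 * x).
(* [col x] determines the class of [x] modulo [GA], and [rep] picks one element for each value of
   [col]. *)
have /choice[rep repP] : forall t, exists y, forall x, col x = t -> col y = t.
  move=> t; have [[x xt]|Nt] := pselect (exists x, col x = t); first by exists x.
  by exists 0 => x xt; case: Nt; exists x.
have rep_GA x : GA (x - rep (col x)).
  move=> k z; rewrite mulrBr; apply: coset_eq.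
  by have /(congr1 (fun h => h (k, z))) := repP _ x erefl.
(* An element is coded by its class modulo [GA] and, for each [k], by the value of [g k] at its
   difference from the representative. *)
pose code x := (col x, fun k => g k (x - rep (col x))).
apply: (@small_inj kappa _ _ _ setT code) => //; last first.
  by apply: small_prod => //; apply: small_fun => //; apply: small_prod.
move=> x y _ _ [cxy /(congr1 (fun h => h _)) gxy].
apply/eqP; rewrite -subr_eq0; apply/negPn/negP => /Gsep[a [k]]; apply.
(* After subtraction of their common representative, [x] and [y] are near the same [z] at level
   [k.+1]; the difference of the two conditions puts [a * (x - y)] into [G k]. *)
have [z xz yz] := gP k.+1 _ _ (rep_GA x) (rep_GA y) (gxy k.+1).
have := GB (xz a) (yz a); rewrite -mulrBr cxy.
by have -> : x - rep (col y) - z - (y - rep (col y) - z) = x - y by ring.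
Qed.

(** Points [c i] and multipliers [al i] are built forwards, so that all earlier multipliers send
    later points into [H]; one pair of points per block is then chosen backwards, which gives the
    other half of the off-diagonal condition. *)
Lemma dual_pattern k : (forall f, big_separated k f) -> forall N, exists a d : nat -> F,
  forall i j, (i < N)%N -> (j < N)%N -> (i <> j -> H (a i * d j)) /\ ~ G k (a i * d i).
Proof.
move=> bigk N.
have /choice[ca caP] : forall f : Z -> F, exists ca : (nu -> F) * (nu -> nu -> F),
    (forall w z, H (f z * ca.1 w)) /\
    forall w w', w <> w' -> ~ G k (ca.2 w w' * (ca.1 w - ca.1 w')).
  move=> f; have [c cH cS] := bigk f.
  have /choice[al alP] : forall ww : nu * nu, exists a,
      ww.1 <> ww.2 -> ~ G k (a * (c ww.1 - c ww.2)).
    move=> [w w']; have [->|ww'] := pselect (w = w'); first by exists 0.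
    by have /existsNP[a Na] := cS _ _ ww'; exists a.
  by exists (c, fun w w' => al (w, w')); split=> // w w' ww'; exact: (alP (w, w')).
(* [fs j] lists the multipliers of all blocks before [j], the latest at index 0; block [i] thus sits
   at index [j - i.+1]. *)
pose fix fs (j : nat) : Z -> F := if j is i.+1 then
  (fun z => if z.1 is m.+1 then fs i (m, z.2) else (ca (fs i)).2 z.2.1 z.2.2)
  else fun=> 0.
pose c i := (ca (fs i)).1; pose al i := (ca (fs i)).2.
have fs_old m i w w' : fs (m + i.+1)%N (m, (w, w')) = al i w w' by elim: m.
have cH i j w w' x : (i < j)%N -> H (al i w w' * c j x).
  move=> ij; have [cj _] := caP (fs j).
  by have := cj x (j - i.+1, (w, w'))%N; rewrite -{1}(subnK ij) fs_old.
pose good (a d : nat -> F) i := exists w w', [/\ w <> w', a i = al i w w',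
  d i = c i w - c i w' & forall j, (i < j)%N -> H (a j * d i)].
(* The pairs are chosen from the last block down: in block i, Cantor's theorem
   yields w <> w' such that c i w - c i w' is sent into H by all later a j. *)
have [a [d adP]] : exists a d, forall i, (N - N <= i < N)%N -> good a d i.
  elim: {2}N => [|m [a [d adP]]].
    exists (fun=> 0), (fun=> 0) => i; rewrite subn0 => /andP[Ni iN].
    by move: (leq_ltn_trans Ni iN); rewrite ltnn.
  have [Nm|mN] := leqP N m.
    exists a, d => i /andP[_ iN]; apply: adP; rewrite iN andbT.
    by move: Nm; rewrite -subn_eq0 => /eqP ->.
  pose i0 := (N - m.+1)%N.
  have [w [w' [ww' E]]] : exists w w' : nu, w <> w' /\
      (fun j => coset (a j * c i0 w)) = (fun j => coset (a j * c i0 w')).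
    apply: contrapT => Nw.
    apply: (@no_injection_powerset _ (fun w : nu => fun j => coset (a j * c i0 w))).
    by move=> w w' E; apply: contrapT => ww'; apply: Nw; exists w, w'.
  exists (upd a i0 (al i0 w w')), (upd d i0 (c i0 w - c i0 w')) => i /andP[i0i iN].
  move: i0i; rewrite -/i0 leq_eqVlt => /predU1P[<-|i0i].
    exists w, w'; rewrite /upd !eqxx; split=> // j i0j.
    rewrite gtn_eqF // mulrBr; apply: coset_eq.
    by have /(congr1 (fun h => h j)) := E.
  have [|x [x' [xx' aE dE adH]]] := adP i.
    by rewrite iN andbT -(subnSK mN).
  exists x, x'; rewrite /upd gtn_eqF //; split=> // j ij.
  by rewrite gtn_eqF; [exact: adH|exact: ltn_trans i0i ij].
have {}adP i : (i < N)%N -> good a d i by move=> iN; apply: adP; rewrite subnn.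
exists a, d => i j iN jN.
have [w [w' [ww' aiE diE adi]]] := adP i iN.
split; last by rewrite aiE diE; apply: (caP (fs i)).2.
have [x [x' [_ _ djE adj]]] := adP j jN.
(* For [i < j] the forward construction applies to both points of block [j]; for [j < i] the
   backward choice does. *)
case: (ltngtP i j) => // [ij _|ji _]; last exact: adj.
by rewrite djE mulrBr aiE; apply: HB; apply: cH.
Qed.

(** With [b I] the sum of the [d j] over [j < N] in [I], the off-diagonal terms of [a i * b I] lie
    in [H]. If [i] is in [I], cancelling them leaves [a i * d i], which is outside [G k]; the
    subtraction costs one level, whence [k.+1]. *)
Lemma bounded_index_pattern : exists k, forall N, exists (a : nat -> F) (b : set nat -> F),
  forall i I, (i < N)%N -> (~ I i -> H (a i * b I)) /\ (I i -> ~ G k (a i * b I)).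
Proof.
have [k bigk] := uniform_big_separated; exists k.+1 => N.
have [a [d adP]] := dual_pattern bigk N.
exists a, (fun I => \sum_(j < N | `[< I j >]) d j) => i I iN.
have sumH (p : pred 'I_N) : ~~ p (Ordinal iN) -> H (a i * \sum_(j < N | p j) d j).
  move=> Npi; rewrite mulr_sumr; apply: (big_ind H) => // j pj.
  apply: (adP i j iN (ltn_ord j)).1 => ij; case/negP: Npi.
  by rewrite (_ : Ordinal iN = j) //; apply: val_inj.
split=> [NI|Ii GI]; first by apply: sumH; apply/asboolP.
apply: (adP i i iN iN).2.
rewrite (bigD1 (Ordinal iN)) /= ?asboolE // mulrDr in GI.
set s := \sum_(j < N | _) _ in GI.
have Gs : G k.+1 (a i * s) by apply/HG/sumH; rewrite eqxx andbF.
by have := GB GI Gs; rewrite addrK.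
Qed.

End BoundedIndex.

(** * Type-definable additive subgroups under NIP *)

Section Connected.
Variables (L : language) (M : structure L) (kappa : Type).
Hypothesis satM : sufficiently_saturated M kappa.
Variables (n : nat) (F : fieldType) (e : F -> n.-tuple M).
Hypothesis e_inj : injective e.
Variables (A : set M) (a0 : M).
Hypotheses (sA : small kappa A) (Aa0 : A a0).
Hypothesis tdK : type_definable_over A (range e).
Hypothesis tdadd : type_definable_over A
  [set t | exists x y : F, t = [tuple of (e x ++ e y) ++ e (x + y)]].
Hypothesis tdmul : type_definable_over A
  [set t | exists x y : F, t = [tuple of (e x ++ e y) ++ e (x * y)]].

Definition dfn1 (V : set F) := rel_dfn e A (fun u => V (u 0%N)).
Definition tdfn1 (V : set F) := rel_tdfn e A (fun u => V (u 0%N)).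

Lemma dfn1_at V k : dfn1 V -> rel_dfn e A (fun u => V (u k)).
Proof. exact: (rel_dfn_subst (fun=> k)). Qed.

Lemma tdfn1_at V k : tdfn1 V -> rel_tdfn e A (fun u => V (u k)).
Proof. exact: (rel_tdfn_subst (s := fun=> k)). Qed.

Lemma tdfn1_sep (H : set F) x : tdfn1 H -> ~ H x ->
  exists V, [/\ dfn1 V, H `<=` V & ~ V x].
Proof.
move=> tH NHx; have [Q [dQ HQ NQ]] := tH (fun=> x) NHx.
exists (fun y => Q (fun=> y)); split=> // [|y Hy]; last exact: HQ.
exact: (rel_dfn_subst (fun=> 0%N) dQ).
Qed.

(** The graph of a power is obtained by induction, the previous power being kept in variable 2 and
    projected away. *)
Lemma tdfn_exp m : rel_tdfn e A (fun u => u 1%N = u 0%N ^+ m.+1).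
Proof.
elim: m => [|m IH].
  by apply: rel_dfn_tdfn; apply: rel_dfn_ext (rel_dfn_eq e_inj A 1 0) => u; rewrite expr1.
apply: rel_tdfn_ext (rel_tdfn_proj satM e_inj sA Aa0 tdK (S := [set k | (k < 2)%N])
  (rel_tdfn_and (rel_tdfn_subst (s := fun k => if k == 0%N then 0%N else 2%N) IH)
    (rel_tdfn_ternary e_inj (i := 0%N) (j := 2%N) (k := 1%N) tdmul))) => u.
split=> [[u' [u'u [/= u'2 u'1]]]|u1].
  by rewrite -(u'u 0%N) // -(u'u 1%N) // u'1 u'2 -exprS.
exists (fun k => if k == 2%N then u 0%N ^+ m.+1 else u k); rewrite /= u1 -exprS; split=> //.
by case=> [|[|[|]]].
Qed.

Lemma tdfn1_preimage_mul (V : set F) : tdfn1 V ->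
  rel_tdfn e A (fun u => V (u 0%N * u 1%N)).
Proof.
move=> tV; apply: rel_tdfn_ext (rel_tdfn_proj satM e_inj sA Aa0 tdK (S := [set k | (k < 2)%N])
  (rel_tdfn_and (tdfn1_at (k := 2%N) tV)
    (rel_tdfn_ternary e_inj (i := 0%N) (j := 1%N) (k := 2%N) tdmul))) => u.
split=> [[u' [u'u [/= Vu'2 u'2]]]|Vu].
  by rewrite -(u'u 0%N) // -(u'u 1%N) // -u'2.
exists (fun k => if k == 2%N then u 0%N * u 1%N else u k); split=> //.
by case=> [|[|[|]]].
Qed.

Lemma tdfn1_artin_schreier (H : set F) p : (0 < p)%N -> tdfn1 H ->
  tdfn1 [set x ^+ p - x | x in H].
Proof.
case: p => // p _ tH.
(* Variable 0 is the value, 1 the argument and 2 its power; the graph of addition expresses that the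
   power is the value plus the argument. *)
apply: rel_tdfn_ext (rel_tdfn_proj satM e_inj sA Aa0 tdK (S := [set k | (k < 1)%N])
  (rel_tdfn_and (tdfn1_at (k := 1%N) tH) (rel_tdfn_and
    (rel_tdfn_subst (s := fun k => if k == 0%N then 1%N else 2%N) (@tdfn_exp p))
    (rel_tdfn_ternary e_inj (i := 0%N) (j := 1%N) (k := 2%N) tdadd)))) => u.
split=> [[u' [u'u [Hu' [/= u'2 u'2E]]]]|[x Hx xu]].
  by exists (u' 1%N) => //; rewrite -u'2 u'2E addrK u'u.
exists (fun k => if k == 0%N then u 0%N else if k == 1%N then x else x ^+ p.+1).
by split=> [[]//|/=]; split=> //; split=> //; rewrite -xu subrK.
Qed.

(** By compactness: otherwise every relatively definable [V] containing [H] has two elements with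
    difference outside [P], hence so does [H], although [H] is closed under differences and
    contained in [P]. *)
Lemma dfn1_half (H P : set F) : (forall x y, H x -> H y -> H (x - y)) ->
  tdfn1 H -> dfn1 P -> H `<=` P ->
  exists V, [/\ dfn1 V, H `<=` V & forall x y, V x -> V y -> P (x - y)].
Proof.
move=> HB tH dP HP; apply: contrapT => NV.
pose E (V : set F) (u : nat -> F) := (V (u 0%N) /\ V (u 1%N)) /\
  (u 0%N = u 2%N + u 1%N /\ ~ P (u 2%N)).
pose D := [set V | dfn1 V /\ H `<=` V].
have DT : D setT by split=> //; exact: rel_dfn_true.
have [|||||u uP] := @rel_saturation L M kappa satM n F e A a0 Aa0 tdK A (E @` D) (E setT) sA.
- by [].
- by exists setT.
- move=> _ _ [V [dV HV] <-] [W [dW HW] <-]; exists (E (V `&` W)).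
    by exists (V `&` W) => //; split; [exact: rel_dfn_and|move=> x /[dup]/HV ? /HW].
  by move=> u [[[? ?] [? ?]] ?].
- move=> _ [V [dV _] <-]; apply: rel_tdfn_and.
    by apply/rel_dfn_tdfn/rel_dfn_and; exact: dfn1_at.
  apply: rel_tdfn_and; first exact: rel_tdfn_ternary.
  by apply/rel_dfn_tdfn/rel_dfn_not/dfn1_at.
- move=> _ [V [dV HV] <-]; apply: contrapT => NE; apply: NV; exists V.
  split=> // x y Vx Vy; apply: contrapT => NP; apply: NE.
  exists (fun k => if k == 0%N then x else if k == 1%N then y else x - y).
  by split=> //=; rewrite subrK.
have uH k : (k < 2)%N -> H (u k).
  move=> k2; apply: contrapT => /(tdfn1_sep tH)[V [dV HV]]; apply.
  have [[V0 V1] _] := uP _ (ex_intro2 _ _ V (conj dV HV) erefl).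
  by case: k k2 => [|[]].
have [_ [u0 NP]] := uP _ (ex_intro2 _ _ setT DT erefl).
by apply/NP/HP; rewrite -(addrK (u 1%N) (u 2%N)) -u0; apply: HB; apply: uH.
Qed.

Lemma tdfn1_bounded_index_full (T : theory L) (H : set F) :
  NIP T -> model T M -> infinite_set [set: F] ->
  H 0 -> (forall x y, H x -> H y -> H (x - y)) -> tdfn1 H ->
  small kappa (cosets setT H) -> forall x, H x.
Proof.
move=> nipT TM infF H0 HB tH bH x0; apply: contrapT => NHx0.
have [V0 [dV0 HV0 NV0]] := tdfn1_sep tH NHx0.
have /choice[half halfP] : forall P : set F, exists V, dfn1 P /\ H `<=` P ->
    (dfn1 V /\ H `<=` V) /\ forall x y, V x -> V y -> P (x - y).
  move=> P; have [[dP HP]|NP] := pselect (dfn1 P /\ H `<=` P); last by exists P.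
  by have [V [dV HV VP]] := dfn1_half HB tH dP HP; exists V.
pose G k := iter k half V0.
have GP k : dfn1 (G k) /\ H `<=` G k.
  by elim: k => [//|k IH]; apply: (halfP _ IH).1.
have [k kP] : exists k, forall N, exists (a : nat -> F) (b : set nat -> F),
    forall i I, (i < N)%N -> (~ I i -> H (a i * b I)) /\ (I i -> ~ G k (a i * b I)).
  apply: (bounded_index_pattern (kappa_strong_limit satM) (small_nat satM)) => //.
  - by move=> k; apply: (GP k).2.
  - by move=> k; apply: (halfP _ (GP k)).2.
  (* Every nonzero element has [x0] as a multiple, and [x0] lies outside [G 0]. *)
  - by move=> x xn0; exists (x0 / x), 0%N; rewrite mulfVK.
  - exact: (infinite_field_large satM e_inj sA Aa0 tdK).
have tN : tdfn1 (fun x => ~ G k x) by apply/rel_dfn_tdfn/rel_dfn_not/(GP k).1.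
(* Multiplication is only type-definable, so neither the product being in [H] nor its being in [G k]
   need be a definable condition; compactness provides a relatively definable [Q] between the
   two. *)
have [Q [dQ HQ NQ]] := rel_tdfn_separation satM sA Aa0 tdK (tdfn1_preimage_mul tH)
  (tdfn1_preimage_mul tN) (fun u Hu NG => NG ((GP k).2 _ Hu)).
(* The negation matches the pattern, in which the product lies in [H] exactly when [i] is not in
   [I]. *)
pose Q' a b := ~ Q (fun k => if k == 0%N then a else b).
apply: (@rel_independence_not_NIP L M kappa satM n F e A a0 sA Aa0 tdK Q' _ _ T TM nipT).
  apply: rel_dfn_not.
  apply: rel_dfn_ext (rel_dfn_subst (fun k => if k == 0%N then 0%N else 1%N) dQ) => u.
  suff -> : (fun k : nat => u (if k == 0%N then 0%N else 1%N)) =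
            (fun k : nat => if k == 0%N then u 0%N else u 1%N) by [].
  by apply/funext => k'; case: (k' == 0%N).
move=> N; have [a [b abP]] := kP N; exists a, b => i I iN; have [abH abG] := abP i I iN.
split=> [NQab|Ii]; first by apply: contrapT => /abH ?; apply: NQab; exact: HQ.
by move=> /NQ; apply; exact: abG.
Qed.

End Connected.

(** * The Artin-Schreier map *)

Lemma small_finite (kappa : Type) (T : eqType) (s : seq T) (B : set T) :
  small kappa [set: nat] -> (forall x, B x -> x \in s) -> small kappa B.
Proof.
move=> sN Bs; apply: (@small_inj kappa _ _ _ _ (index^~ s) _ _ sN) => // x y /Bs xs /Bs ys xy.
by rewrite -(nth_index x xs) xy nth_index.
Qed.

Lemma poly_roots_seq (F : fieldType) (q : {poly F}) : q != 0 ->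
  exists s : seq F, forall x, root q x -> x \in s.
Proof.
elim: {q}(size q) {-2}q (leqnn (size q)) => [|m IH] q.
  by rewrite leqn0 size_poly_eq0 => /eqP -> /eqP.
move=> qm q0; have [[x qx]|Nx] := pselect (exists x, root q x); last first.
  by exists [::] => x qx; case: Nx; exists x.
have /factor_theorem[r qE] := qx.
have r0 : r != 0 by apply: contraNneq q0 => r0; rewrite qE r0 mul0r.
have [|//|s sP] := IH r.
  by move: qm; rewrite qE size_Mmonic ?monicXsubC // size_XsubC addn2.
exists (x :: s) => y; rewrite qE rootM root_XsubC inE => /orP[/sP ->|->] //.
by rewrite orbT.
Qed.

(** A coset is determined by its image and by a kernel element [z] comparing its representative,
    modulo [H], with that of a chosen coset having the same image. *)
Lemma small_cosets_image (kappa : Type) (V : zmodType) (G H : set V) (f : V -> V) :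
  strong_limit kappa -> small kappa [set: nat] ->
  (forall x y, f (x - y) = f x - f y) -> small kappa [set x | f x = 0] ->
  (forall x y, H x -> H y -> H (x - y)) -> H 0 ->
  small kappa (cosets (f @` G) (f @` H)) -> small kappa (cosets G H).
Proof.
move=> klim sN fB sker HB H0 sfGH.
have Hcoset x y : H (x - y) -> [set x + h | h in H] = [set y + h | h in H].
  have sub a b : H (a - b) -> [set a + h | h in H] `<=` [set b + h | h in H].
    move=> Hab _ [h Hh <-]; exists (h - (b - a)); last first.
      by rewrite opprB addrC addrA subrK addrC.
    apply: (HB) => //; rewrite -opprB -sub0r; exact: HB.
  by move=> Hxy; apply/seteqP; split; apply: sub => //; rewrite -opprB -sub0r; exact: HB.
have /choice[r rP] : forall c, exists x, cosets G H c -> G x /\ [set x + h | h in H] = c.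
  by move=> c; have [[x Gx xc]|Nc] := pselect (cosets G H c); [exists x|exists 0].
pose im c := [set f (r c) + y | y in f @` H].
have /choice[c0 c0P] : forall t, exists c0, forall c, im c = t -> im c0 = t.
  move=> t; have [[c ct]|Nt] := pselect (exists c, im c = t); first by exists c.
  by exists set0 => c ct; case: Nt; exists c.
have /choice[z zP] : forall c, exists z, f z = 0 /\ H (r c - r (c0 (im c)) - z).
  have f0 : f 0 = 0 by rewrite -{1}(subrr (0 : V)) fB subrr.
  move=> c; have : im c (f (r c)) by exists 0; [exists 0|rewrite addr0].
  rewrite -{1}(c0P _ c erefl) => -[_ [h Hh <-] E].
  exists (r c - r (c0 (im c)) - h); split; last by rewrite subKr.
  by rewrite !fB -E [X in X - _]addrAC subrr add0r subrr.
have := small_setX klim sfGH sker.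
apply: (@small_inj kappa _ _ _ _ (fun c => (im c, z c))) => [c Cc|c c' Cc Cc' [imE zE]].
  split=> /=; last by have [] := zP c.
  by exists (f (r c)) => //; exists (r c) => //; have [] := rP c Cc.
have [_ <-] := rP _ Cc; have [_ <-] := rP _ Cc'; apply: Hcoset.
have := HB _ _ (zP c).2 (zP c').2; rewrite imE zE.
by rewrite opprD addrACA subrr addr0 opprD addrACA subrr addr0.
Qed.

Lemma type_definable_over_subset (L : language) (M : structure L) (A B : set M)
    (m : nat) (D : set (m.-tuple M)) :
  A `<=` B -> type_definable_over A D -> type_definable_over B D.
Proof. by move=> AB [q qA DE]; exists q => // f qf i; apply/AB/qA. Qed.

Lemma artin_schreierB (F : fieldType) (p : nat) : p \in [pchar F] ->
  forall x y : F, (x - y) ^+ p - (x - y) = (x ^+ p - x) - (y ^+ p - y).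
Proof.
move=> charF x y.
by rewrite -!(pFrobenius_autE charF) rmorphB /=; ring.
Qed.

Lemma artin_schreier_kernel (F : fieldType) (p : nat) : (1 < p)%N ->
  exists s : seq F, forall x, x ^+ p - x = 0 -> x \in s.
Proof.
move=> p1; have [|s sP] := @poly_roots_seq F ('X^p - 'X).
  rewrite -size_poly_gt0 size_polyDl size_polyXn // size_polyN size_polyX; exact: p1.
by exists s => x x0; apply: sP; rewrite rootE !hornerE x0.
Qed.

Theorem theorem4p8 (L : language) (T : theory L) (kappa : Type)
  (M : structure L) (n : nat) (F : fieldType) (e : F -> n.-tuple M) (p : nat) :
  NIP T ->
  model T M ->
  sufficiently_saturated M kappa ->
  type_definable_field kappa e ->
  infinite_set [set: F] ->
  p \in [pchar F] ->
  ~ (exists H : nat -> set F,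
       [/\ forall i, type_definable_subgroup kappa e (H i),
           forall i, H i.+1 `<=` H i
         & forall i, unbounded_index kappa (H i) (H i.+1)]) ->
  artin_schreier_closed F p.
Proof.
move=> nipT TM satM [e_inj [AK [qK [sAK AKq KE]]] [Aadd [qadd [sAadd Aaddq addE]]]
  [Amul [qmul [sAmul Amulq mulE]]]] infF charF chain.
have klim := kappa_strong_limit satM; have sN := small_nat satM.
have p_gt1 : (1 < p)%N by apply: prime_gt1; case/andP: charF.
have p_gt0 : (0 < p)%N by apply: ltnW.
(* In an empty structure [e 0] and [e 1] would be equal tuples; [a0] serves as the dummy
   parameter. *)
have [a0 _] : exists a0 : M, True.
  apply: contrapT => NM; have /eqP := oner_neq0 F; apply; apply: e_inj.
  by apply: eq_from_tnth => i; case: NM; exists (tnth (e 0) i).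
pose A := AK `|` Aadd `|` Amul `|` [set a0].
have sA : small kappa A.
  have s1 : small kappa [set a0].
    by apply: (@small_inj kappa _ _ _ _ (fun=> 0%N) _ _ sN) => // x y -> ->.
  by do 3! [apply: (small_setU klim sN); last by []].
have Aa0 : A a0 by right.
have tdK : type_definable_over A (range e).
  by apply: (@type_definable_over_subset _ _ AK); [by move=> x; do 3! left|exists qK].
have tdadd : type_definable_over A
    [set t | exists x y : F, t = [tuple of (e x ++ e y) ++ e (x + y)]].
  by apply: (@type_definable_over_subset _ _ Aadd);
    [by move=> x; left; left; right|exists qadd].
have tdmul : type_definable_over A
    [set t | exists x y : F, t = [tuple of (e x ++ e y) ++ e (x * y)]].
  by apply: (@type_definable_over_subset _ _ Amul); [by move=> x; left; right|exists qmul].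
pose wp (x : F) := x ^+ p - x.
have wpB x y : wp (x - y) = wp x - wp y by exact: artin_schreierB.
have wp0 : wp 0 = 0 by rewrite -{1}(subrr (0 : F)) wpB subrr.
pose H i := iter i (fun G : set F => wp @` G) setT.
have H0 i : H i 0 by elim: i => [//|i IH]; exists 0.
have HB i x y : H i x -> H i y -> H i (x - y).
  elim: i x y => [//|i IH] _ _ [x Hx <-] [y Hy <-].
  by exists (x - y); [exact: IH|exact: wpB].
have tH i : tdfn1 e A (H i).
  elim: i => [|i IH]; first by apply: rel_dfn_tdfn; exact: rel_dfn_true.
  exact: (tdfn1_artin_schreier satM e_inj sA Aa0 tdK tdadd tdmul).
(* Otherwise the iterated images [H i] would form a chain excluded by hypothesis. *)
have [i bi] : exists i, small kappa (cosets (H i) (H i.+1)).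
  apply: contrapT => Nb; apply: chain; exists H; split=> i.
  - by split; [exact: H0|exact: HB|exact: (type_definable_image sA Aa0 tdK (tH i))].
  - by elim: i => [x _ //|i IH] _ [x Hx <-]; exists x => //; exact: IH.
  - by move=> sHi; apply: Nb; exists i.
have [s sP] := artin_schreier_kernel F p_gt1.
have sker : small kappa [set x | wp x = 0] by apply: small_finite sP.
(* As [wp] has finite kernel, bounded index descends along the chain from step [i] to step 0. *)
have b0 : small kappa (cosets (H 0%N) (H 1%N)).
  elim: i bi => [//|i IH] bi.
  exact: IH (small_cosets_image klim sN wpB sker (HB i.+1) (H0 i.+1) bi).
move=> a; have [x _ xa] : H 1%N a.
  exact: (tdfn1_bounded_index_full satM e_inj sA Aa0 tdK tdadd tdmul nipT TM infF
    (H0 1%N) (HB 1%N) (tH 1%N) b0).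
by exists x.
Qed.
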